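(* Let $X$ be an analytic metric space and $n$ a positive integer. If $\dim_{\mathsf P} X>n$, then there is a little Lipschitz surjective mapping $f:X\to[0,1]^n$.
   Context: All spaces are separable metric spaces; $[0,1]^n$ carries the Euclidean metric. A metric space is analytic if it is a continuous image of a complete separable metric space. $B(x,r)$ denotes the closed ball with center $x$ and radius $r>0$. A mapping $f:X\to Y$ between metric spaces is little Lipschitz if $\operatorname{lip} f(x)=\liminf_{r\to0}\frac{\operatorname{diam} f(B(x,r))}{r}$ (with $r>0$) is finite for every $x\in X$. Packing measure. Let $E$ be a subset of a metric space $X$. A family of balls $\{B(x_i,r_i):i\in I\}$ is a packing of $E$ if $x_i\in E$ for all $i$ and $x_j\notin B(x_i,r_i)$ whenever $i\neq j$. It is $\delta$-fine if $r_i\le\delta$ for all $i$. For $s>0$ let $\mathcal P^s_\delta(E)=\sup\{\sum_{i\in I}r_i^s:\{B(x_i,r_i):i\in I\}\text{ is a }\delta\text{-fine packing of }E\}$, $\mathcal P^s_0(E)=\inf_{\delta>0}\mathcal P^s_\delta(E)$, and $\mathcal P^s(E)=\inf\sum_k\mathcal P^s_0(E_k)$, the infimum being over all countable covers $\{E_k\}$ of $E$. Packing dimension: $\dim_{\mathsf P}E=\inf\{s>0:\mathcal P^s(E)=0\}\in[0,\infty]$. *)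

(* Defs.v *)
From HB Require Import structures.
From mathcomp Require Import all_boot all_order all_algebra.
From mathcomp Require Import all_classical all_reals all_analysis.

Set Implicit Arguments.
Unset Strict Implicit.
Unset Printing Implicit Defensive.

Import Order.TTheory GRing.Theory Num.Theory.
Import numFieldNormedType.Exports.

Local Open Scope classical_set_scope.
Local Open Scope ring_scope.

Definition separable_space (T : topologicalType) : Prop :=
  exists2 D : set T, countable D & dense D.

(* The library's [cvg] and completeness structure require a base point,
   which the empty space lacks. *)
Definition complete_space (T : uniformType) : Prop :=
  forall F : set_system T, ProperFilter F -> cauchy F ->
    exists l : T, F --> l.

Definition analytic_space (R : realType) (X : metricType R) : Prop :=
  exists P : metricType R,
    [/\ complete_space P, separable_space P
      & exists2 g : P -> X, continuous g & set_surj setT setT g].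

(* Every analytic space is separable, so separability of X need not be assumed
   separately. *)
Lemma analytic_separable (R : realType) (X : metricType R) :
  analytic_space X -> separable_space X.
Proof.
move=> [P [_ [D cD dD] [g cg sg]]]; exists (g @` D).
  exact: card_le_trans (card_image_le _ _) cD.
move=> U [x Ux] oU; have [p _ gpx] := sg x I.
have [|q [/= Uq Dq]] := dD (g @^-1` U) _ (open_comp (in1W cg) oU).
  by exists p; rewrite /preimage/= gpx.
by exists (g q); split => //; exists q.
Qed.

(* The library's [closed_ball] is the closure of the open ball, which may be
   smaller than the set below. *)
Definition cball (R : realType) (X : metricType R) (x : X) (r : R) : set X :=
  [set y | mdist x y <= r].

(* Only meaningful for nonempty sets: the value at [set0] is [-oo]. *)
Definition diam (R : realType) (X : metricType R) (A : set X) : \bar R :=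
  ereal_sup [set (mdist u v)%:E | u in A & v in A].

Definition lip (R : realType) (X Y : metricType R) (f : X -> Y) (x : X)
    : \bar R :=
  limf_einf (fun r : R => (diam (f @` cball x r) * (r^-1)%:E)%E) 0^'+.

Definition little_lipschitz (R : realType) (X Y : metricType R) (f : X -> Y)
    : Prop :=
  forall x, lip f x \is a fin_num.

Section packing.
Context {R : realType} {X : metricType R}.
Implicit Types (E : set X) (s delta : R).

(* A family of balls is given by its families of centers and radii. *)
Definition is_packing E (I : Type) (x : I -> X) (r : I -> R) : Prop :=
  [/\ forall i, 0 < r i, forall i, E (x i)
    & forall i j, i <> j -> ~ cball (x i) (r i) (x j)].

Definition fine_family (delta : R) (I : Type) (r : I -> R) : Prop :=
  forall i, r i <= delta.

Definition packing_premeasure_at s delta E : \bar R :=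
  ereal_sup [set t | exists (I : choiceType) (x : I -> X) (r : I -> R),
    [/\ is_packing E x r, fine_family delta r
      & t = \esum_(i in [set: I]) (r i `^ s)%:E]].

Definition packing_premeasure s E : \bar R :=
  ereal_inf [set packing_premeasure_at s delta E | delta in [set d | 0 < d]].

Definition packing_measure s E : \bar R :=
  ereal_inf [set t | exists2 A : (set X)^nat, E `<=` \bigcup_k A k &
    t = (\sum_(k <oo) packing_premeasure s (A k))%E].

Definition packing_dim E : \bar R :=
  ereal_inf [set s%:E | s in [set s : R | 0 < s /\ packing_measure s E = 0%E]].

End packing.

Record unit_cube (R : realType) (n : nat) := UnitCube {
  cube_val :> 'rV[R]_n;
  cube_valP : [forall i, 0 <= cube_val ord0 i <= 1] }.

HB.instance Definition _ (R : realType) n :=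
  [isSub for @cube_val R n].
HB.instance Definition _ (R : realType) n :=
  [Choice of unit_cube R n by <:].

Section euclidean.
Context {R : realType} {n : nat}.
Implicit Types (a b c : 'I_n -> R) (x y z : unit_cube R n).

Let sqn a := \sum_i a i ^+ 2.

Let sqn_ge0 a : 0 <= sqn a.
Proof. by apply: sumr_ge0 => i _; exact: sqr_ge0. Qed.

Let cauchy_schwarz a b : \sum_i a i * b i <= Num.sqrt (sqn a) * Num.sqrt (sqn b).
Proof.
rewrite -sqrtrM//; apply: le_trans (ler_norm _) _; rewrite -sqrtr_sqr.
rewrite ler_wsqrtr//.
have : 0 <= \sum_i \sum_j (a i * b j - a j * b i) ^+ 2.
  by apply: sumr_ge0 => i _; apply: sumr_ge0 => j _; exact: sqr_ge0.
under eq_bigr do under eq_bigr do rewrite sqrrB.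
under eq_bigr do rewrite big_split sumrB/=.
rewrite big_split sumrB/=.
have -> : \sum_i \sum_j (a i * b j) ^+ 2 = sqn a * sqn b.
  rewrite mulr_suml; apply: eq_bigr => i _; rewrite mulr_sumr.
  by apply: eq_bigr => j _; rewrite exprMn.
have -> : \sum_i \sum_j (a j * b i) ^+ 2 = sqn a * sqn b.
  rewrite exchange_big/= mulr_suml; apply: eq_bigr => i _; rewrite mulr_sumr.
  by apply: eq_bigr => j _; rewrite exprMn.
have -> : \sum_i \sum_j (a i * b j * (a j * b i) *+ 2)
        = (\sum_i a i * b i) ^+ 2 *+ 2.
  rewrite expr2 mulr_suml -sumrMnl; apply: eq_bigr => i _.
  rewrite mulr_sumr -sumrMnl; apply: eq_bigr => j _.
  by congr (_ *+ 2); rewrite -!mulrA; congr (_ * _); rewrite mulrA mulrC [b j * _]mulrC.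
by rewrite addrAC -mulr2n subr_ge0 lerMn2r.
Qed.

Let minkowski a b :
  Num.sqrt (sqn (fun i => a i + b i)) <= Num.sqrt (sqn a) + Num.sqrt (sqn b).
Proof.
have h : 0 <= Num.sqrt (sqn a) + Num.sqrt (sqn b) by rewrite addr_ge0.
rewrite -[leRHS](ger0_norm h) -sqrtr_sqr ler_wsqrtr// sqrrD !sqr_sqrtr//.
rewrite /sqn; under eq_bigr do rewrite sqrrD.
rewrite !big_split/= -mulr2n lerD2r lerD2l lerMn2r/=.
exact: cauchy_schwarz.
Qed.

Definition cube_dist x y : R :=
  Num.sqrt (\sum_(i < n) (x ord0 i - y ord0 i) ^+ 2).

Lemma cube_distxx x : cube_dist x x = 0.
Proof.
by rewrite /cube_dist big1 ?sqrtr0// => i _; rewrite subrr expr0n.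
Qed.

Lemma cube_dist_positivity x y : cube_dist x y = 0 -> x = y.
Proof.
move=> /eqP; rewrite sqrtr_eq0 => le0; apply/val_inj/rowP => i /=.
have := sqn_ge0 (fun i => x ord0 i - y ord0 i).
rewrite le_eqVlt ltNge le0 orbF eq_sym psumr_eq0 => [|j _]; last exact: sqr_ge0.
by move=> /allP/(_ i (mem_index_enum i)); rewrite sqrf_eq0 subr_eq0 => /eqP.
Qed.

Lemma cube_dist_sym x y : cube_dist x y = cube_dist y x.
Proof.
by congr Num.sqrt; apply: eq_bigr => i _; rewrite -opprB sqrrN.
Qed.

Lemma cube_dist_triangle y x z : cube_dist x z <= cube_dist x y + cube_dist y z.
Proof.
apply: le_trans (minkowski _ _); rewrite ler_wsqrtr// le_eqVlt.
by apply/orP; left; apply/eqP/eq_bigr => i _; rewrite addrA subrK.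
Qed.

HB.instance Definition _ := @isMetric.Build R (unit_cube R n) cube_dist
  cube_distxx cube_dist_positivity cube_dist_sym cube_dist_triangle.

End euclidean.

(* Main.v *)
Require Import Defs.
From HB Require Import structures.
From mathcomp Require Import all_boot all_order all_algebra.
From mathcomp Require Import all_classical all_reals all_analysis.
From mathcomp Require Import ring lra.

(** Call a set box-small if, at all fine dyadic scales 2 ^- k, it has no
    2 ^ (k * n) points that are pairwise more than 2 ^- k apart, and thin if it
    is covered by countably many box-small sets. Sorting the balls of a packing
    by dyadic radius shows that the packing premeasure of exponent s > n of a
    box-small set is 0 ([box_small_packing_premeasure]); hence a thin set has
    packing dimension at most n ([packing_dim_thin_le]), and X is not thin.

    Let g be a continuous map from a complete separable space P onto X. Points
    of P having a neighborhood with thin image may be discarded, as together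
    they have a thin image ([thin_image_setC_thick]). Near each of the other
    points, the thick ones, there are for arbitrarily large k families of
    2 ^ (k * n) thick points whose images are pairwise more than 2 ^- k apart
    ([thick_point_spread]).

    This makes it possible to build a finitely branching tree of pairs of a thick
    point and a subcube of the unit cube. The children of a pair divide its cube
    into 2 ^ (k * n) equal cubes, with k depending on the pair, and sit at such a
    family of nearby thick points ([subdivision]). Around the image of each thick
    point put a ball of radius a quarter of the side of the cube: balls of
    siblings are disjoint, since this side is at most 2 ^- k, and the ball of a
    child is well inside that of its parent.

    The map sends x to the coordinatewise supremum, over all nodes, of the lowest
    corner of the cube times a Lipschitz bump function, which is 1 on half the
    ball and 0 outside the ball ([cube_map]). If x lies in balls of all levels,
    there are arbitrarily small radii r, proportional to the sides of the cubes
    at x, such that the ball of radius r around x is mapped into a cube of side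
    16 r ([cube_map_deep]); between two such radii, the only cube known to contain
    the image may have a side much larger than the radius, hence the liminf. At the other points only finitely
    many bumps matter and the map is locally Lipschitz ([cube_map_shallow]). It
    is onto because every point of the unit cube is selected by a branch of the
    tree, along which the thick points converge, by completeness of P
    ([cube_map_surj]). *)

Import Order.TTheory GRing.Theory Num.Theory.
Import numFieldNormedType.Exports.

Local Open Scope classical_set_scope.
Local Open Scope ring_scope.

Set Implicit Arguments.
Unset Strict Implicit.
Unset Printing Implicit Defensive.

(** * Spread families and packing sums *)

Section separated_families.
Context {R : realType} {X : metricType R}.
Implicit Types A E : set X.

Definition spread (T : Type) (d : R) (q : T -> X) : Prop :=
  forall a b, a <> b -> d < mdist (q a) (q b).

(** A quantitative upper bound n for the box dimension, read at dyadic scales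
    only. The index type has 2 ^ (k * n) elements, the number of cells of the
    grid of mesh 2 ^- k of the unit n-cube, so that a spread family refuting
    this property comes already labelled by the cells of such a grid. *)
Definition box_small (n : nat) A : Prop :=
  exists k0, forall k, (k0 <= k)%N ->
    ~ exists q : {ffun 'I_n -> 'I_(2 ^ k)} -> X,
        (forall a, A (q a)) /\ spread (2 ^- k) q.

(** The centers of the balls of radius more than d of a packing are pairwise
    more than d apart, so #|T| of them would make up a spread family. *)
Lemma size_packing_lt (T : finType) A (I : choiceType) (x : I -> X)
    (r : I -> R) (d : R) (s : seq I) :
  is_packing A x r -> uniq s -> (forall i, i \in s -> d < r i) ->
  (~ exists q : T -> X, (forall a, A (q a)) /\ spread d q) ->
  (size s < #|T|)%N.
Proof.
move=> [r0 Ax xr] us ds nq; rewrite ltnNge; apply/negP => Ts; apply: nq.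
case: s => [|i0 s] in us ds Ts *.
  have T0 : T -> False.
    by move=> a; move: Ts; rewrite leqn0 => /eqP/card0_eq/(_ a); rewrite inE.
  by exists (fun a => match T0 a with end); split => [a|a]; case: (T0 a).
have szs (a : T) : (enum_rank a < size (i0 :: s))%N.
  exact: leq_trans (ltn_ord _) Ts.
exists (fun a => x (nth i0 (i0 :: s) (enum_rank a))); split => [a|a b ab].
  exact: Ax.
apply: lt_trans (ds _ (mem_nth i0 (szs a))) _; rewrite ltNge; apply/negP.
apply: xr => /eqP; rewrite nth_uniq// => /eqP/val_inj/enum_rank_inj.
exact: ab.
Qed.

Lemma dyadic_scale (x : R) (k1 : nat) : 0 < x -> x <= 2 ^- k1 ->
  exists2 k, (k1 <= k)%N & 2 ^- k.+1 < x <= 2 ^- k.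
Proof.
move=> x0 xk1.
have exk : exists k, 2 ^- k.+1 < x.
  have := @cvg_geometric R 1 2^-1; rewrite ger0_norm ?invr_ge0// invf_lt1 ?ltr1n//.
  move=> /(_ isT)/cvgrPdist_lt/(_ x x0)[k _ /(_ k.+1)] /= /(_ (leqnSn k)).
  rewrite sub0r normrN mul1r ger0_norm ?exprn_ge0 ?invr_ge0// exprVn => H.
  by exists k.
case: (ex_minnP exk) => k kx kmin; exists k; last first.
  apply/andP; split => //; case: k => [|k] in kx kmin *; last first.
    by rewrite leNgt; apply/negP => /kmin; rewrite ltnn.
  apply: le_trans xk1 _; rewrite expr0 invr1 invf_le1 ?exprn_gt0//.
  by rewrite exprn_ege1// ler1n.
rewrite leqNgt; apply/negP => kk1.
have := lt_le_trans kx xk1; rewrite ltf_pV2 ?posrE ?exprn_gt0// ltNge.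
by rewrite ler_weXn2l ?ler1n.
Qed.

End separated_families.

(** Balls with radii in ]2 ^- k.+1, 2 ^- k] number fewer than 2 ^ (n * k.+1) in
    a packing of a box-small set, so they contribute at most 2 ^ n * theta ^ k
    to the sum of the s-th powers, where theta = 2 ^ (n - s) is less than 1. *)
Section packing_sums.
Context {R : realType} {X : metricType R}.
Context (n : nat) (s : R) (ns : n%:R < s).

Let theta : R := 2 ^+ n * 2 `^ (- s).

Let theta01 : 0 < theta < 1.
Proof.
rewrite /theta mulr_gt0 ?exprn_gt0 ?powR_gt0//=.
rewrite -powR_mulrn// -powRD; last by rewrite pnatr_eq0 implybT.
rewrite /powR pnatr_eq0/= expR_lt1 pmulr_llt0 ?subr_lt0//.
by rewrite ln_gt0// ltr1n.
Qed.

Let powR_dyadic k : (2 ^- k) `^ s = (2 `^ (- s)) ^+ k :> R.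
Proof.
rewrite -!powR_mulrn ?powR_ge0// -powRN -!powRrM.
by congr (_ `^ _); ring.
Qed.

(** The tail of the geometric series is of the order of theta ^ k1, hence
    vanishes as the fineness 2 ^- k1 tends to 0. *)
Lemma finite_packing_sum_le (A : set X) : box_small n A ->
  exists (k0 : nat) (C t : R), [/\ 0 <= C, 0 < t < 1 &
    forall (k1 : nat) (I : choiceType) (x : I -> X) (r : I -> R) (l : seq I),
    (k0 <= k1)%N -> uniq l -> is_packing A x r -> fine_family (2 ^- k1) r ->
    \sum_(i <- l) r i `^ s <= C * t ^+ k1].
Proof.
have /andP[t0 t1] := theta01.
move=> [k0 nA]; exists k0, (2 ^+ n / (1 - theta)), theta; split => //.
  by rewrite mulr_ge0 ?exprn_ge0// invr_ge0 subr_ge0 ltW.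
move=> k1 I x r l k01 ul pA rk1; have [r0 _ _] := pA.
have /choice[kap kapP] : forall i, exists k, (k1 <= k)%N /\ 2 ^- k.+1 < r i <= 2 ^- k.
  by move=> i; have [k] := dyadic_scale (r0 i) (rk1 i); exists k.
pose N := (\max_(i <- l) kap i).+1.
have kapN i : i \in l -> (kap i < k1 + N)%N.
  move=> il; rewrite /N addnS ltnS; apply: leq_trans (leq_addl _ _).
  exact: leq_bigmax_seq.
have -> : \sum_(i <- l) r i `^ s =
    \sum_(k1 <= k < k1 + N) \sum_(i <- l | kap i == k) r i `^ s.
  rewrite (exchange_big_dep xpredT)//= big_seq [RHS]big_seq.
  apply: eq_bigr => i il.
  rewrite (eq_bigl _ _ (fun j => eq_sym (kap i) j)) big_nat1_eq.
  by rewrite (kapN _ il) (kapP i).1.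
apply: (@le_trans _ _ (\sum_(k1 <= k < k1 + N) 2 ^+ n * theta ^+ k)).
  apply: ler_sum_nat => k /andP[k1k _].
  apply: (@le_trans _ _ (\sum_(i <- l | kap i == k) (2 `^ (- s)) ^+ k)).
    apply: ler_sum => i /eqP ki; rewrite -powR_dyadic.
    have /andP[_] := (kapP i).2; rewrite ki => rk.
    apply: ge0_ler_powR; rewrite ?nnegrE ?invr_ge0 ?exprn_ge0//; last exact: ltW.
    by apply: le_trans (ltW ns).
  rewrite -big_filter big_const_seq count_predT iter_addr_0.
  rewrite -[leLHS]mulr_natl /theta.
  rewrite [in leRHS]exprMn mulrA ler_wpM2r ?exprn_ge0 ?powR_ge0//.
  rewrite -exprS -exprM -natrX ler_nat.
  have := @size_packing_lt R X {ffun 'I_n -> 'I_(2 ^ k.+1)} A I x r (2 ^- k.+1)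
    [seq i <- l | kap i == k] pA.
  rewrite filter_uniq// => /(_ isT).
  rewrite card_ffun !card_ord -expnM mulnC => H.
  apply/ltnW; apply: H; last first.
    by apply: nA; apply: leq_trans k01 _; exact: leq_trans k1k (leqnSn _).
  move=> i; rewrite mem_filter => /andP[/eqP ki _].
  by have /andP[] := (kapP i).2; rewrite ki.
rewrite -mulr_sumr -mulrA ler_wpM2l ?exprn_ge0// geometric_partial_tail mulrC.
by apply: geometric_le_lim; rewrite ?exprn_ge0 ?ltW// gtr0_norm.
Qed.

End packing_sums.

(** * Thin sets and packing dimension *)

Section thin_sets.
Context {R : realType} {X : metricType R} (n : nat).
Implicit Types A E : set X.

Lemma packing_premeasure_at_ge0 s d A : (0 <= packing_premeasure_at s d A)%E.
Proof.
apply: le_ereal_sup_tmp; exists 0%E => //.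
exists void, (@of_void X), (@of_void R).
by split; [split; case|case|rewrite esum1//; case].
Qed.

Lemma packing_premeasure_ge0 s A : (0 <= packing_premeasure s A)%E.
Proof.
by apply: le_ereal_inf_tmp => _ [d _ <-]; exact: packing_premeasure_at_ge0.
Qed.

Lemma box_small_packing_premeasure (s : R) A :
  n%:R < s -> box_small n A -> packing_premeasure s A = 0%E.
Proof.
move=> ns bA; apply/eqP; rewrite eq_le packing_premeasure_ge0 andbT.
have [k0 [C [t [C0 t01 H]]]] := finite_packing_sum_le ns bA.
apply/lee_addgt0Pr => e e0; rewrite add0e.
have := @cvg_geometric R C t; rewrite ger0_norm; last by case/andP: t01 => /ltW.
case/andP: t01 => t0 t1 /(_ t1)/cvgrPdist_lt/(_ e e0)[k1 _ /(_ (maxn k0 k1))] /=.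
rewrite leq_maxr => /(_ isT); set k := maxn k0 k1.
rewrite sub0r normrN ger0_norm ?mulr_ge0 ?exprn_ge0 ?(ltW t0)// => /ltW Ce.
apply: (@le_trans _ _ (packing_premeasure_at s (2 ^- k) A)).
  by apply: ereal_inf_lbound; exists (2 ^- k) => //=; rewrite invr_gt0 exprn_gt0.
apply: ge_ereal_sup => _ [I [x [r [pA fr ->]]]].
apply: ge_ereal_sup => _ [F [finF _] <-].
rewrite fsumEFin// lee_fin fsbig_finite//.
apply: le_trans Ce; apply: H pA fr => //; first exact: leq_maxl.
Qed.

(** This plays the role of having packing dimension at most n. Unlike the
    vanishing of a packing measure, it is stable under countable unions by
    mere reindexing. *)
Definition thin E : Prop :=
  exists2 A : (set X)^nat, E `<=` \bigcup_k A k & forall k, box_small n (A k).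

Lemma sub_box_small A B : A `<=` B -> box_small n B -> box_small n A.
Proof.
move=> AB [k0 nB]; exists k0 => k kk0 [q [Aq sq]]; apply: (nB k kk0).
by exists q; split => // a; exact/AB/Aq.
Qed.

Lemma box_small0 : box_small n (set0 : set X).
Proof.
exists 0%N => k _ [q [q0 _]]; apply: (q0 [ffun=> Ordinal (_ : 0 < 2 ^ k)%N]).
by rewrite expn_gt0.
Qed.

Lemma sub_thin E E' : E `<=` E' -> thin E' -> thin E.
Proof. by move=> EE' [A EA bA]; exists A => //; exact: subset_trans EA. Qed.

Lemma box_small_thin E : box_small n E -> thin E.
Proof. by move=> bE; exists (fun=> E) => // x Ex; exists 0%N. Qed.

Lemma thin_bigcup (T : choiceType) (D : set T) (F : T -> set X) : countable D ->
  (forall t, D t -> thin (F t)) -> thin (\bigcup_(t in D) F t).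
Proof.
move=> /countable_injP[c cinj] FD.
have /choice[A AP] : forall t, exists A : (set X)^nat, D t ->
    F t `<=` \bigcup_k A k /\ forall k, box_small n (A k).
  move=> t; have [Dt|nDt] := pselect (D t); last by exists (fun=> set0).
  by have [A ? ?] := FD t Dt; exists A.
pose B j := \bigcup_(u in [set u : T * nat | D u.1 /\ pickle (c u.1, u.2) = j])
  A u.1 u.2.
exists B => [x [t Dt Ftx]|j].
  have [k _ Akx] := (AP t Dt).1 _ Ftx.
  by exists (pickle (c t, k)) => //; exists (t, k).
have [[[t k] /= [Dt tkj]]|nj] :=
  pselect (exists u : T * nat, D u.1 /\ pickle (c u.1, u.2) = j).
  apply: sub_box_small ((AP t Dt).2 k) => x [[t' k'] /= [Dt' tkj']].
  have /(pcan_inj (@pickleK _))[ctt ->] : pickle (c t', k') = pickle (c t, k).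
    by rewrite tkj.
  by rewrite (cinj _ _ _ _ ctt) ?inE.
by apply: sub_box_small box_small0 => x [u uj _]; apply: nj; exists u.
Qed.

(** For every s > n the box-small pieces form a cover on which the packing
    premeasures of exponent s vanish. *)
Lemma packing_dim_thin_le E : thin E -> (packing_dim E <= (n%:R : R)%:E)%E.
Proof.
move=> [A EA bA]; apply/lee_addgt0Pr => e e0; rewrite -EFinD.
have ns : n%:R < n%:R + e by rewrite ltrDl.
apply: ereal_inf_lbound; exists (n%:R + e) => //=; split.
  by apply: le_lt_trans ns.
apply/eqP; rewrite eq_le; apply/andP; split.
  apply: ereal_inf_lbound; exists A => //.
  by rewrite eseries0// => k _ _; exact: box_small_packing_premeasure.
apply: le_ereal_inf_tmp => _ [B _ ->].
by apply: nneseries_ge0 => k _ _; exact: packing_premeasure_ge0.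
Qed.

End thin_sets.

(** * Thick points of a parametrization *)

Section thick_points.
Context {R : realType} {P X : metricType R} (n : nat) (g : P -> X).

(** The points to keep: those none of whose neighborhoods has a thin image. *)
Definition thick_points : set P :=
  [set p | forall e, 0 < e -> ~ thin n (g @` [set q | mdist p q < e])].

(** Lindelöf argument: a point that is not thick has a thin image of a ball
    around it, which can be shrunk to one of countably many balls with center
    in a countable dense set and radius the inverse of an integer. *)
Lemma thin_image_setC_thick : separable_space P -> thin n (g @` ~` thick_points).
Proof.
move=> [D cD dD].
pose B (u : P * nat) : set P := [set q | mdist u.1 q < u.2.+1%:R^-1].
pose D' : set (P * nat) := [set u | D u.1 /\ thin n (g @` B u)].
apply: (@sub_thin _ _ _ _ (\bigcup_(u in D') (g @` B u))); last first.
  apply: thin_bigcup => [|u []//]; apply: (@sub_countable _ _ _ (D `*` setT)).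
    by apply: subset_card_le => u [].
  by apply: countableX => //; exact: countableP.
move=> _ [p /existsNP[e /not_implyP[e0 /contrapT the]] <-].
have [m _ /(_ m (leqnn _)) /= me] :=
  near_infty_natSinv_lt (PosNum (divr_gt0 e0 (ltr0n R 2))).
have [||d [/interior_subset pd Dd]] := dD (ball p m.+1%:R^-1)°.
- by exists p; apply: nbhsx_ballx; rewrite invr_gt0.
- exact: open_interior.
rewrite ballEmdist /= in pd.
exists (d, m); last by exists p => //=; rewrite /B/= metric_sym.
split => //; apply: sub_thin the => _ [q dq <-]; exists q => //=.
apply: le_lt_trans (metric_triangle p d q) _.
by have := ltrD pd dq => /= /lt_trans -> //; rewrite [ltRHS]splitr ltrD.
Qed.

Lemma thinU (A B : set X) : thin n A -> thin n B -> thin n (A `|` B).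
Proof.
move=> tA tB; apply: (@sub_thin _ _ _ _ (\bigcup_(b in [set: bool]) if b then A else B)).
  by move=> x [Ax|Bx]; [exists true|exists false].
by apply: thin_bigcup => [|[]//]; exact: countableP.
Qed.

(** The image of a small ball around p is not thin, while the points that are
    not thick contribute only a thin part to it. So the image of the thick
    points of this ball is not box-small, and it contains spread families at
    arbitrarily fine scales. *)
Lemma thick_point_spread (p : P) (e : R) : separable_space P -> continuous g ->
  thick_points p -> 0 < e ->
  exists2 k, 2 ^- k < e & exists q : {ffun 'I_n -> 'I_(2 ^ k)} -> P,
    (forall a, [/\ thick_points (q a), mdist p (q a) < e
                 & mdist (g p) (g (q a)) < e]) /\
    spread (2 ^- k) (g \o q).
Proof.
move=> sP cg Kp e0.
have /(metricType_numDomainType.cvgrPdist_lt) /(_ e e0) := cg p.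
move=> /metricType_numDomainType.nbhs_mdistP [d /= d0 gd].
pose m := Num.min d e; have m0 : 0 < m by rewrite lt_min d0.
pose E := g @` ([set q | mdist p q < m] `&` thick_points).
have [k0 /= k0e] : exists k0, forall k, (k0 <= k)%N -> 2 ^- k < e.
  have [k0 _ k0e] := near_infty_natSinv_expn_lt (PosNum e0).
  by exists k0 => k /k0e /=; rewrite div1r.
have : ~ box_small n E.
  move=> /box_small_thin tE; apply: (Kp m m0).
  apply: sub_thin (thinU tE (thin_image_setC_thick sP)) => _ [q pq <-].
  by have [Kq|nKq] := pselect (thick_points q); [left|right]; exists q.
move=> /forallNP/(_ k0)/existsNP[k /not_implyP[/k0e ke /contrapT[q [Eq sq]]]].
have /choice[q' q'P] : forall a, exists p',
    (mdist p p' < m /\ thick_points p') /\ g p' = q a.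
  by move=> a; have [p' p'P <-] := Eq a; exists p'.
exists k => //; exists q'; split=> [a|a b ab]; last first.
  by rewrite /= !(q'P _).2; exact: sq.
have [[]] := q'P a; rewrite lt_min => /andP[pd pe] Ka _; split => //.
exact: gd.
Qed.

Lemma thick_points_nonempty : separable_space P -> ~ thin n (g @` setT) ->
  thick_points !=set0.
Proof.
move=> sP ntX; apply/set0P/eqP => K0; apply: ntX.
by have := thin_image_setC_thick sP; rewrite K0 setC0.
Qed.

End thick_points.

(** * Bounds for the little Lipschitz constant and the cube metric *)

Section little_lipschitz_criterion.
Context {R : realType}.

(** As a liminf is at stake, a linear bound along some radii tending to 0 is
    enough; these radii may depend on the point. *)
Lemma little_lipschitz_le (X Y : metricType R) (f : X -> Y) :
  (forall x, exists C, forall d, 0 < d -> exists r, [/\ 0 < r, r < d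
     & forall u v, cball x r u -> cball x r v -> mdist (f u) (f v) <= C * r]) ->
  little_lipschitz f.
Proof.
move=> Hf x; have [C HC] := Hf x; rewrite /lip limf_einfE ge0_fin_numE.
  apply: (@le_lt_trans _ _ C%:E); last by rewrite ltry.
  apply: ge_ereal_sup => _ [V /nbhs_ballP[d /= d0 dV] <-].
  have [r [r0 rd Hr]] := HC d d0.
  apply: le_trans (ereal_inf_lbound _) _.
    exists r; last reflexivity.
    by apply: dV => //=; rewrite /ball/= sub0r normrN gtr0_norm.
  rewrite lee_pdivrMr// -EFinM; apply: ge_ereal_sup => _ [_ [u xu <-]] [_ [v xv <-]] <-.
  by rewrite lee_fin Hr.
apply: le_ereal_sup_tmp; exists (ereal_inf
    ((fun r : R => (diam (f @` cball x r) * (r^-1)%:E)%E) @` [set r | 0 < r])).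
  by exists [set r | 0 < r] => //; exact: nbhs_right_gt.
apply: le_ereal_inf_tmp => _ [r /= r0 <-].
apply: mule_ge0; last by rewrite lee_fin invr_ge0 ltW.
apply: le_ereal_sup_tmp; exists 0%E => //; exists (f x).
  by exists x => //; rewrite /cball/= mdistxx ltW.
exists (f x); last by rewrite mdistxx.
by exists x => //; rewrite /cball/= mdistxx ltW.
Qed.

Lemma mdist_cube_le (n : nat) (x y : unit_cube R n) (a : R) : 0 <= a ->
  (forall i, `|x ord0 i - y ord0 i| <= a) -> mdist x y <= n%:R * a.
Proof.
move=> a0 xya; have na0 : 0 <= n%:R * a by rewrite mulr_ge0.
rewrite -[leRHS](ger0_norm na0) -sqrtr_sqr ler_wsqrtr//.
apply: (@le_trans _ _ (\sum_(i < n) a ^+ 2)).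
  apply: ler_sum => i _; rewrite -[leLHS]real_normK ?num_real//.
  by rewrite ler_pXn2r ?nnegrE.
rewrite sumr_const card_ord exprMn -[leLHS]mulr_natl ler_wpM2r ?sqr_ge0//.
rewrite -natrX ler_nat -mulnn.
by have [->//|n0] := posnP n; rewrite leq_pmulr.
Qed.

End little_lipschitz_criterion.

(** * The tree of cubes *)

Lemma grid_cell (R : realType) (u : R) (N : nat) : (0 < N)%N -> 0 <= u <= 1 ->
  exists a : 'I_N, a%:R <= u * N%:R <= a%:R + 1.
Proof.
move=> N0 /andP[u0]; rewrite le_eqVlt => /orP[/eqP ->|u1].
  have aN : (N.-1 < N)%N by rewrite prednK.
  by exists (Ordinal aN) => /=; rewrite mul1r natr1 prednK// lexx andbT ler_nat leq_pred.
have uN0 : 0 <= u * N%:R by rewrite mulr_ge0.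
have /andP[a0 a1] := truncn_itv uN0.
have aN : (Num.trunc (u * N%:R) < N)%N.
  by rewrite -(ltr_nat R) (le_lt_trans a0)// gtr_pMl// ltr0n.
by exists (Ordinal aN) => /=; rewrite a0 natr1 ltW.
Qed.

Lemma finite_inf_gt0 (R : realType) (T : Type) (A : set T) (h : T -> R) : finite_set A ->
  (forall a, A a -> 0 < h a) -> exists2 d, 0 < d & forall a, A a -> d <= h a.
Proof.
elim/Ppointed: T => T in A h *.
  by move=> _ _; exists 1 => // a; have := no a.
move=> finA h0; have [l lA] : exists l : seq T, forall a, A a <-> a \in l.
  by have /finite_seqP[l ->] := finA; exists l.
elim: l A finA h0 lA => [|a l IH] A finA h0 lA.
  by exists 1 => // a /lA.
have [|||d d0 dl] := IH [set x | x \in l].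
- exact: finite_seq.
- by move=> b /= bl; apply: h0; apply/lA; rewrite inE bl orbT.
- by [].
exists (Num.min d (h a)); first by rewrite lt_min d0 h0//; apply/lA; rewrite mem_head.
move=> b /lA; rewrite inE => /orP[/eqP ->|bl]; first by rewrite ge_min lexx orbT.
by rewrite ge_min dl.
Qed.

(** A node records a point of the parameter space P, whose image is the center
    of balls of X of radius proportional to [side], and a subcube of the unit
    cube, given by its lowest corner and its side. That the same number [side]
    governs the ball and the cube is what makes the final map little
    Lipschitz. *)
Section tree.
Context {R : realType} {P X : metricType R} (n : nat).
Context (g : P -> X) (K : set P).

Record node := Node { ctr : P; corner : 'I_n -> R; side : R }.
Implicit Types s t : node.

Definition node_ball s (c : R) : set X := cball (g (ctr s)) (c * side s).

Definition cube s : set ('I_n -> R) :=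
  [set y | forall i, corner s i <= y i <= corner s i + side s].

Record valid s : Prop := Valid {
  valid_ctr : K (ctr s);
  valid_side : 0 < side s <= 1;
  valid_corner : forall i, 0 <= corner s i;
  valid_top : forall i, corner s i + side s <= 1 }.

(** The radii are a quarter of the side for the ball that carries a node, an
    eighth for the ball on which its bump function is 1. The sixteenth in
    [sub_ball] leaves room: a ball of radius a sixteenth of the side around any
    point of a child's ball stays where the bump of the parent is 1. The balls
    of [sub_ctr] are nested in P in order that centers along a branch form a
    Cauchy sequence. *)
Record subdivides s (T : set node) : Prop := Subdivides {
  sub_finite : finite_set T;
  sub_valid : forall t, T t -> valid t;
  sub_half : forall t, T t -> side t <= side s / 2;
  sub_corner : forall t, T t -> forall i, corner s i <= corner t i;
  sub_top : forall t, T t ->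
    forall i, corner t i + side t <= corner s i + side s;
  sub_ball : forall t, T t -> node_ball t (1 / 4) `<=` node_ball s (1 / 16);
  sub_ctr : forall t, T t -> cball (ctr t) (2 * side t) `<=` cball (ctr s) (2 * side s);
  sub_disj : forall t t' x, T t -> T t' ->
    node_ball t (1 / 4) x -> node_ball t' (1 / 4) x -> t = t';
  sub_cover : forall y, cube s y -> exists2 t, T t & cube t y }.

(** Cut the cube of s into 2 ^ (k * n) equal cubes, and place them at the points
    of a spread family. The points are more than 2 ^- k apart in X and the new
    sides are at most 2 ^- k, since the side of s is at most 1; so balls of
    radius a quarter of the new side are disjoint. *)
Lemma subdivision s :
  (forall (p : P) (e : R), K p -> 0 < e ->
    exists2 k, 2 ^- k < e & exists q : {ffun 'I_n -> 'I_(2 ^ k)} -> P,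
      (forall a, [/\ K (q a), mdist p (q a) < e & mdist (g p) (g (q a)) < e]) /\
      spread (2 ^- k) (g \o q)) ->
  valid s -> exists T, subdivides s T.
Proof.
case: s => p c l K_spread [/= Kp /andP[l0 l1] c0 c1].
(* A child's ball has radius at most l / 32 too, which adds up to l / 16. *)
have e0 : 0 < l / 32 by rewrite divr_gt0.
have [k ke [q [qP sq]]] := K_spread _ _ Kp e0.
have k0 : 0 < 2 ^- k :> R by rewrite invr_gt0 exprn_gt0.
have k2 : 2 ^- k <= 1 / 32 :> R by lra.
set h : R := l * 2 ^- k.
have h0 : 0 < h by rewrite mulr_gt0.
have hk : h <= 2 ^- k by rewrite ler_piMl // ltW.
have hl : h <= l / 32 by rewrite /h ler_wpM2l ?(ltW l0)//; lra.
have hN : h * (2 ^ k)%:R = l by rewrite natrX -mulrA mulVf ?mulr1// expf_neq0.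
pose T (a : {ffun 'I_n -> 'I_(2 ^ k)}) := Node (q a) (fun i => c i + h * (a i)%:R) h.
have top (a : {ffun 'I_n -> 'I_(2 ^ k)}) i : c i + h * (a i)%:R + h <= c i + l.
  by rewrite -addrA -{2}[h]mulr1 -mulrDr natr1 -hN lerD2l ler_wpM2l ?(ltW h0)// ler_nat.
have low (a : {ffun 'I_n -> 'I_(2 ^ k)}) i : c i <= c i + h * (a i)%:R.
  by rewrite lerDl mulr_ge0// ltW.
exists (range T); split => /=.
- by apply: finite_image; exact: finite_finset.
- move=> _ [a _ <-]; split => //=; first by have [] := qP a.
  + by rewrite h0; lra.
  + by move=> i; exact: le_trans (low a i).
  + by move=> i; exact: le_trans (top a i) (c1 i).
- by move=> _ [a _ <-] /=; lra.
- by move=> _ [a _ <-] i; exact: low.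
- by move=> _ [a _ <-] i; exact: top.
- move=> _ [a _ <-] x; rewrite /node_ball /cball /= => ax.
  have [_ _ pa] := qP a.
  have := metric_triangle (g p) (g (q a)) x; lra.
- move=> _ [a _ <-] x; rewrite /cball /= => ax.
  have [_ pa _] := qP a.
  have := metric_triangle p (q a) x; lra.
- move=> _ _ x [a _ <-] [b _ <-]; rewrite /node_ball /cball /= => ax bx.
  have [->//|/eqP/sq /= kab] := eqVneq a b.
  exfalso; have := metric_triangle (g (q a)) x (g (q b)).
  by rewrite (metric_sym x); lra.
move=> y cy.
have /choice[a aP] : forall i, exists a : 'I_(2 ^ k),
    a%:R <= (y i - c i) / l * (2 ^ k)%:R <= a%:R + 1.
  move=> i; apply: grid_cell; first by rewrite expn_gt0.
  have /andP[cyi yci] := cy i.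
  by rewrite divr_ge0 ?subr_ge0 ?(ltW l0)//= ler_pdivrMr// mul1r lerBlDl.
exists (T (finfun a)); first by exists (finfun a).
move=> i /=; rewrite ffunE; have := aP i.
have -> : (y i - c i) / l * (2 ^ k)%:R = (y i - c i) / h.
  rewrite -hN; field.
  by rewrite gt_eqF// pnatr_eq0 expn_eq0.
rewrite ler_pdivlMr// ler_pdivrMr// mulrDl mul1r (mulrC h).
by move=> /andP[? ?]; apply/andP; split; lra.
Qed.

Context (ch : node -> set node)
  (chP : forall s, valid s -> subdivides s (ch s))
  (root : node) (root_valid : valid root).

Fixpoint level (k : nat) : set node :=
  if k is k'.+1 then \bigcup_(s in level k') ch s else [set root].

Lemma level_valid k s : level k s -> valid s.
Proof.
elim: k s => [_ ->//|k IH t [s ks st]].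
exact: sub_valid (chP (IH _ ks)) _ st.
Qed.

Lemma level_finite k : finite_set (level k).
Proof.
elim: k => [|k IH]; first exact: finite_set1.
by apply: bigcup_finite => // s /level_valid/chP[].
Qed.

Lemma level_side k s : level k s -> side s <= 2 ^- k.
Proof.
elim: k s => [_ ->|k IH t [s ks st]].
  by rewrite expr0 invr1; have /andP[] := valid_side root_valid.
have := sub_half (chP (level_valid ks)) st; have := IH _ ks.
by rewrite exprSr invfM; lra.
Qed.

Lemma node_ballS s c d : valid s -> c <= d -> node_ball s c `<=` node_ball s d.
Proof.
move=> [_ /andP[l0 _] _ _] cd x; rewrite /node_ball /cball /= => /le_trans; apply.
by rewrite ler_wpM2r// ltW.
Qed.

Lemma child_ball k s t : level k s -> ch s t ->
  node_ball t (1 / 4) `<=` node_ball s (1 / 4).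
Proof.
move=> /level_valid vs st; apply: subset_trans (sub_ball (chP vs) st) _.
by apply: node_ballS => //; lra.
Qed.

(** Balls of distinct nodes of the same level are disjoint: a common point
    would lie in the balls of the parents, which are then equal. *)
Lemma level_inj k s t x : level k s -> level k t ->
  node_ball s (1 / 4) x -> node_ball t (1 / 4) x -> s = t.
Proof.
elim: k s t => [_ _ -> -> //|k IH t t' [s ks st] [s' ks' st'] tx tx'].
have ss : s = s'.
  by apply: IH => //; [exact: (child_ball ks st tx)|exact: (child_ball ks' st' tx')].
rewrite -{}ss {ks' s'} in st'.
exact: (sub_disj (chP (level_valid ks)) st st' tx tx').
Qed.

Definition below s t := node_ball t (1 / 4) `<=` node_ball s (1 / 4) /\
  forall i, corner s i <= corner t i /\ corner t i + side t <= corner s i + side s.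

Lemma level_below k j t : level (k + j) t -> exists2 s, level k s & below s t.
Proof.
elim: j t => [|j IH] t; first by rewrite addn0 => kt; exists t => //; split.
rewrite addnS => -[u kju ut]; have [s ks [ball_us cube_us]] := IH _ kju.
have us := chP (level_valid kju).
exists s => //; split; first exact: subset_trans (child_ball kju ut) ball_us.
move=> i; have [c1 c2] := cube_us i; split.
  exact: le_trans c1 (sub_corner us ut i).
exact: le_trans (sub_top us ut i) c2.
Qed.

(** * The map attached to a tree *)

Definition bump s x : R :=
  Num.max 0 (Num.min 1 (2 - 8 * mdist (g (ctr s)) x / side s)).

Lemma bump01 s x : 0 <= bump s x <= 1.
Proof. by rewrite /bump le_max lexx ge_max ler01 ge_min lexx. Qed.

Lemma bump1 s x : valid s -> node_ball s (1 / 8) x -> bump s x = 1.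
Proof.
move=> [_ /andP[l0 _] _ _]; rewrite /node_ball /cball /bump /= => sx.
have : 8 * mdist (g (ctr s)) x / side s <= 1 by rewrite ler_pdivrMr//; lra.
move=> h; rewrite min_l; last by lra.
by rewrite max_r.
Qed.

Lemma bump0 s x : valid s -> ~ node_ball s (1 / 4) x -> bump s x = 0.
Proof.
move=> [_ /andP[l0 _] _ _]; rewrite /node_ball /cball /bump /=.
move=> /negP; rewrite -ltNge => sx.
have : 2 <= 8 * mdist (g (ctr s)) x / side s by rewrite ler_pdivlMr//; lra.
move=> h; rewrite max_l// ge_min; apply/orP; right; lra.
Qed.

Lemma bump_lipschitz s x y : valid s ->
  `|bump s x - bump s y| <= 8 / side s * mdist x y.
Proof.
move=> [_ /andP[l0 _] _ _]; rewrite /bump.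
set a := mdist _ x; set b := mdist _ y; set d := mdist x y.
have h0 : 0 < 8 / side s by rewrite divr_gt0.
have ab : 8 * a / side s <= 8 * b / side s + 8 / side s * d.
  rewrite mulrAC [8 * b / _]mulrAC -mulrDr ler_wpM2l ?(ltW h0)//.
  by rewrite /d metric_sym; exact: metric_triangle.
have ba : 8 * b / side s <= 8 * a / side s + 8 / side s * d.
  rewrite mulrAC [8 * a / _]mulrAC -mulrDr ler_wpM2l ?(ltW h0)//.
  exact: metric_triangle.
have d0 : 0 <= 8 / side s * d by rewrite mulr_ge0 ?(ltW h0)// mdist_ge0.
move: ab ba d0; set u := 8 * a / _; set v := 8 * b / _; set w := _ * d => ? ? ?.
by rewrite ler_norml /Num.max /Num.min; do 4?case: ifPn; rewrite -?leNgt; move=> *; lra.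
Qed.

(** Corners increase coordinatewise from a node to its children, so along a
    branch on which all bumps are 1 the supremum is the limit of the corners. A
    supremum, as opposed to a series of increments, is well defined at once and
    inherits the Lipschitz bounds of its terms. *)
Definition node_values x i : set R :=
  [set corner s i * bump s x | s in \bigcup_k level k].

Definition cube_map x i : R := sup (node_values x i).

Lemma node_value01 k s x i : level k s -> 0 <= corner s i * bump s x <= 1.
Proof.
move=> /level_valid[_ /andP[l0 _] /(_ i) c0 /(_ i) c1].
have /andP[b0 b1] := bump01 s x.
by rewrite mulr_ge0//= mulr_ile1//; lra.
Qed.

Lemma node_values_neq0 x i : node_values x i !=set0.
Proof. by exists (corner root i * bump root x), root => //; exists 0%N. Qed.

Lemma node_values_sup x i : has_sup (node_values x i).
Proof.
split; first exact: node_values_neq0.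
by exists 1 => _ [s [k _ ks] <-]; have /andP[] := node_value01 x i ks.
Qed.

Lemma node_value_le k s x i : level k s -> corner s i * bump s x <= cube_map x i.
Proof.
move=> ks; apply: ub_le_sup; first by case: (node_values_sup x i).
by exists s => //; exists k.
Qed.

Lemma cube_map01 x i : 0 <= cube_map x i <= 1.
Proof.
apply/andP; split.
  have r0 : level 0 root by [].
  by apply: le_trans (node_value_le x i r0); have /andP[] := node_value01 x i r0.
apply: ge_sup => [|_ [s [k _ ks] <-]]; first exact: node_values_neq0.
by have /andP[] := node_value01 x i ks.
Qed.

(** The lower bound is the value of the node s itself, whose bump is 1 at x. For
    the upper bound, a node t whose bump is not 0 at x has its ball meeting the
    ball of s, so that it is an ancestor of s, with a smaller corner, or a
    descendant of s, with a corner in the cube of s. *)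
Lemma cube_map_cube k s x : level k s -> node_ball s (1 / 8) x -> cube s (cube_map x).
Proof.
move=> ks sx i; have vs := level_valid ks; have [_ /andP[l0 _] c0 c1] := vs.
apply/andP; split.
  by rewrite -[leLHS]mulr1 -(bump1 vs sx); exact: node_value_le ks.
apply: ge_sup => [|_ [t [j _ jt] <-]]; first exact: node_values_neq0.
have vt := level_valid jt; have [_ /andP[lt0 _] ct0 ct1] := vt.
have [tx|ntx] := pselect (node_ball t (1 / 4) x); last first.
  by rewrite bump0// mulr0 addr_ge0// ltW.
have sx4 : node_ball s (1 / 4) x by apply: node_ballS sx => //; lra.
have /andP[b0 b1] := bump01 t x.
apply: (@le_trans _ _ (corner t i)); first by rewrite ler_piMr.
have [kj|jk] := leqP k j.
  move: jt; rewrite -(subnKC kj) => /level_below[s' ks' [bs' /(_ i)[cs1 cs2]]].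
  have ss : s = s' by apply: level_inj ks ks' sx4 _; exact: bs'.
  by rewrite ss; lra.
move: ks; rewrite -(subnKC (ltnW jk)) => /level_below[t' jt' [bt' /(_ i)[ct1' ct2']]].
have -> : t = t' by apply: level_inj jt jt' tx _; exact: bt'.
lra.
Qed.

Lemma cube_map_lipschitz (L : R) i (B : set X) :
  (forall k s y z, level k s -> B y -> B z ->
    `|bump s y - bump s z| <= L * mdist y z) ->
  forall y z, B y -> B z -> `|cube_map y i - cube_map z i| <= L * mdist y z.
Proof.
move=> HB.
have le y z : B y -> B z -> cube_map y i <= cube_map z i + L * mdist y z.
  move=> By Bz; apply: ge_sup => [|_ [s [k _ ks] <-]]; first exact: node_values_neq0.
  have [_ /andP[l0 _] /(_ i) c0 /(_ i) c1] := level_valid ks.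
  have := node_value_le z i ks; have := HB _ _ _ _ ks By Bz.
  rewrite ler_norml => /andP[_ byz] cz.
  rewrite -lerBlDl; apply: le_trans (lerB (lexx _) cz) _.
  rewrite -mulrBr; have Lyz : 0 <= L * mdist y z.
    by apply: le_trans (HB _ _ _ _ ks By Bz).
  apply: (@le_trans _ _ (corner s i * (L * mdist y z))); first by rewrite ler_wpM2l.
  by rewrite ler_piMl//; lra.
move=> y z By Bz; rewrite ler_norml; apply/andP; split.
  by have := le z y Bz By; rewrite (metric_sym z); lra.
by have := le y z By Bz; lra.
Qed.

(** A point in balls of all levels: if s is the node of level k of its branch,
    the ball of radius side s / 16 around x is mapped into the cube of s, whose
    side is 16 times that radius. *)
Lemma cube_map_deep x : (forall k, exists2 s, level k s & node_ball s (1 / 4) x) ->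
  forall d, 0 < d -> exists r, [/\ 0 < r, r < d &
    forall i u v, cball x r u -> cball x r v ->
      `|cube_map u i - cube_map v i| <= 16 * r].
Proof.
move=> xk d d0.
have [k _ /(_ k (leqnn _))/= kd] := near_infty_natSinv_expn_lt (PosNum d0).
have [t [s ks st] tx] := xk k.+1.
have vs := level_valid ks; have /andP[l0 _] := valid_side vs.
have sx := sub_ball (chP vs) st tx.
exists (side s / 16); split; first by rewrite divr_gt0.
  apply: le_lt_trans kd; rewrite div1r; have := level_side ks; lra.
move=> i u v xu xv.
have near_s w : cball x (side s / 16) w -> cube s (cube_map w).
  move=> xw; apply: cube_map_cube ks _; move: sx xw; rewrite /node_ball /cball /=.
  by move=> sx xw; have := metric_triangle (g (ctr s)) x w; lra.
have /(_ i)/andP[u1 u2] := near_s _ xu; have /(_ i)/andP[v1 v2] := near_s _ xv.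
by rewrite ler_norml; apply/andP; split; lra.
Qed.

(** A point outside all balls of some level k0 is at positive distance from
    them, as they are finitely many. Near it, the nodes of level at least k0
    have zero bumps, and the finitely many other bumps have a common Lipschitz
    constant. *)
Lemma cube_map_shallow x k0 : ~ (exists2 s, level k0 s & node_ball s (1 / 4) x) ->
  exists d L, [/\ 0 < d, 0 < L & forall i u v, cball x d u -> cball x d v ->
      `|cube_map u i - cube_map v i| <= L * mdist u v].
Proof.
move=> nx.
have [d d0 dP] : exists2 d, 0 < d & forall s, level k0 s ->
    d <= (mdist (g (ctr s)) x - 1 / 4 * side s) / 2.
  apply: finite_inf_gt0 => [|s ks]; first exact: level_finite.
  rewrite divr_gt0// subr_gt0 ltNge; apply/negP => sx; apply: nx.
  by exists s.
have [m m0 mP] : exists2 m, 0 < m & forall s, (\bigcup_(k in `I_k0) level k) s ->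
    m <= side s / 8.
  apply: finite_inf_gt0 => [|s [k _ ks]].
    by apply: bigcup_finite => // k _; exact: level_finite.
  by have [_ /andP[l0 _] _ _] := level_valid ks; rewrite divr_gt0.
exists d, m^-1; split => //; first by rewrite invr_gt0.
move=> i; apply: cube_map_lipschitz => k s u v ks xu xv.
have vs := level_valid ks; have /andP[l0 _] := valid_side vs.
have [kk0|k0k] := ltnP k k0.
  apply: le_trans (bump_lipschitz _ _ vs) _; rewrite ler_wpM2r ?mdist_ge0//.
  rewrite -[leLHS]invrK lef_pV2 ?posrE ?invr_gt0 ?divr_gt0//.
  by rewrite invf_div; apply: mP; exists k.
have far w : cball x d w -> bump s w = 0.
  move=> xw; apply: bump0 => // sw.
  move: ks; rewrite -(subnKC k0k) => /level_below[t kt [/(_ _ sw) tw _]].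
  have := dP _ kt; move: xw tw; rewrite /node_ball /cball /= => xw tw.
  have := metric_triangle (g (ctr t)) w x; rewrite (metric_sym w).
  by lra.
by rewrite !far// subrr normr0 mulr_ge0 ?mdist_ge0// invr_ge0 ltW.
Qed.

Lemma cube_map_little_lipschitz x : exists C, forall d, 0 < d ->
  exists r, [/\ 0 < r, r < d & forall i u v, cball x r u -> cball x r v ->
    `|cube_map u i - cube_map v i| <= C * r].
Proof.
have [xk|/existsNP[k /cube_map_shallow[d [L [d0 L0 dL]]]]] :=
  pselect (forall k, exists2 s, level k s & node_ball s (1 / 4) x).
  by exists 16; exact: cube_map_deep.
exists (2 * L) => e e0; exists (Num.min d e / 2).
have m0 : 0 < Num.min d e by rewrite lt_min d0.
have [md me] : Num.min d e <= d /\ Num.min d e <= e.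
  by rewrite !ge_min !lexx orbT.
split; [lra|lra|move=> i u v xu xv].
have := metric_triangle u x v; rewrite (metric_sym u x) => uv.
apply: le_trans (dL i u v _ _) _; [move: xu|move: xv|]; rewrite /cball /=; try lra.
rewrite [2 * L]mulrC -mulrA ler_pM2l//.
by move: xu xv; rewrite /cball /=; lra.
Qed.

(** Follow a branch of nodes whose cubes contain y. Their centers form a Cauchy
    sequence in P; the image under g of its limit lies in all the balls of the
    branch, so that its value and y share cubes with sides tending to 0. *)
Lemma cube_map_surj (y : 'I_n -> R) : complete_space P -> continuous g ->
  cube root y -> exists x, cube_map x = y.
Proof.
move=> cP cg ry.
have /choice[nxt nxtP] : forall s, exists t, valid s -> cube s y -> ch s t /\ cube t y.
  move=> s; have [[vs sy]|nvs] := pselect (valid s /\ cube s y); last first.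
    by exists s => vs sy; case: nvs.
  by have [t st ty] := sub_cover (chP vs) sy; exists t.
pose b k := iter k nxt root.
have bP k : level k (b k) /\ cube (b k) y.
  elim: k => [//|k [kb by_]]; have [bb byn] := nxtP _ (level_valid kb) by_.
  by split => //; exists (b k).
have lb k : level k (b k) by have [] := bP k.
have bb k : ch (b k) (b k.+1).
  by have [kb by_] := bP k; have [] := nxtP _ (level_valid kb) by_.
have l0 k : 0 < side (b k) by have [_ /andP[]] := level_valid (lb k).
have ctrP k j : cball (ctr (b k)) (2 * side (b k)) (ctr (b (k + j)%N)).
  elim: j k => [|j IH] k; first by rewrite addn0 /cball/= mdistxx mulr_ge0// ltW.
  by apply: (sub_ctr (chP (level_valid (lb k))) (bb k)); rewrite addnS -addSn.
have ctrX k j : node_ball (b k) (1 / 16) (g (ctr (b (k.+1 + j)%N))).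
  apply: (sub_ball (chP (level_valid (lb k))) (bb k)).
  elim: j k => [|j IH] k.
    by rewrite addn0 /node_ball /cball/= mdistxx; have := l0 k.+1; rewrite /b/=; lra.
  apply: (child_ball (lb k.+1) (bb k.+1)).
  by rewrite addnS -addSn.
have [p bp] : exists p : P, ctr (b k) @[k --> \oo] --> p.
  apply: (cP (fmap (fun k => ctr (b k)) \oo) _); apply: cauchy_exP => e e0.
  have e20 : 0 < e / 2 by rewrite divr_gt0.
  have [k _ /(_ k (leqnn _))/= ke] := near_infty_natSinv_expn_lt (PosNum e20).
  exists (ctr (b k)), k => // j /= kj; rewrite ballEmdist /= -(subnKC kj).
  apply: le_lt_trans (ctrP k _) _; have := level_side (lb k).
  by move: ke; rewrite div1r; lra.
have gbp : g (ctr (b k)) @[k --> \oo] --> g p.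
  by apply: (cvg_comp _ g bp); exact: cg.
exists (g p); apply/funext => i.
apply/eqP; rewrite -subr_eq0 -normr_le0; apply/ler_addgt0Pl => e e0; rewrite addr0.
have [k _ /(_ k (leqnn _))/= ke] := near_infty_natSinv_expn_lt (PosNum e0).
have /cube_map_cube -/(_ k (lb k) i)/andP[c1 c2] : node_ball (b k) (1 / 8) (g p).
  have l160 : 0 < side (b k) / 16 by rewrite divr_gt0.
  have /metricType_numDomainType.cvgrPdist_lt/(_ _ l160)[N _ /(_ (k.+1 + N)%N)] := gbp.
  move=> /(_ (leq_addl _ _)) /=; have := ctrX k N.
  rewrite /node_ball /cball /= metric_sym => d1 d2.
  have := metric_triangle (g p) (g (ctr (b (k.+1 + N)%N))) (g (ctr (b k))).
  by rewrite metric_sym; lra.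
have /andP[y1 y2] := (bP k).2 i; have := level_side (lb k).
by move: ke; rewrite div1r ler_norml => ? ?; apply/andP; split; lra.
Qed.

End tree.

(** * The surjection onto the cube *)

Theorem theorem5p3 (R : realType) (X : metricType R) (n : nat)
    (n_gt0 : (0 < n)%N) (anX : analytic_space X)
    (dimX : ((n%:R : R)%:E < packing_dim [set: X])%E) :
  exists2 f : X -> unit_cube R n,
    little_lipschitz f & set_surj [set: X] [set: unit_cube R n] f.
Proof.
have [P [cP sP [g cg sg]]] := anX.
have [p0 Kp0] : thick_points n g !=set0.
  apply: thick_points_nonempty => // tX.
  move: dimX; rewrite ltNge; apply/negP; rewrite negbK; apply: packing_dim_thin_le.
  by apply: sub_thin tX.
have /choice[ch chP] : forall s : @node R P n, exists T, valid (thick_points n g) s ->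
    subdivides g (thick_points n g) s T.
  move=> s; have [vs|nvs] := pselect (valid (thick_points n g) s); last by exists set0.
  have [T sT] := subdivision (fun p e => @thick_point_spread _ _ _ _ _ p e sP cg) vs.
  by exists T.
pose root := @Node R P n p0 (fun=> 0) 1.
have vr : valid (thick_points n g) root by split => //= *; rewrite ?ltr01 ?add0r lexx.
pose F := cube_map g ch root.
have F01 x : [forall i, 0 <= (\row_j F x j) ord0 i <= 1].
  by apply/forallP => i; rewrite mxE; exact: (cube_map01 chP vr).
exists (fun x => UnitCube (F01 x)).
  apply: little_lipschitz_le => x.
  have [C HC] := cube_map_little_lipschitz chP vr x.
  exists (n%:R * C) => d d0; have [r [r0 rd Hr]] := HC d d0; exists r; split => //.
  move=> u v xu xv; rewrite -mulrA; apply: mdist_cube_le => [|i].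
    by apply: le_trans (Hr (Ordinal n_gt0) u v xu xv).
  by rewrite /= !mxE; exact: Hr.
move=> y _; have [x xy] : exists x, cube_map g ch root x = (fun i => y ord0 i).
  apply: (cube_map_surj chP vr) => // i /=; rewrite add0r.
  by have /forallP := cube_valP y; exact.
exists x => //; apply/val_inj/rowP => i /=.
by rewrite mxE /F xy.
Qed.
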